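(* Let $G$ be the group of order 18 presented by generators $x_1,x_2,a$ and relations $a^2=1$, $x_1^3=x_2^3=1$, $x_1x_2=x_2x_1$, $a x_i a^{-1}=x_i^{-1}$ $(i=1,2)$, and put $w=a$. Let $\Pi=\Pi_{m_1,m_2}$ be one of the two-dimensional irreducible representations of $G$ defined in the context, with $m_1,m_2\in\{-1,0,1\}$ and $(m_1,m_2)\ne(0,0)$. Then its trace character $\chi_\Pi$ is given, for $0\le\beta_1,\beta_2\le 2$ and $\sigma\in\{0,1\}$, by $$\chi_\Pi(x_1^{\beta_1}x_2^{\beta_2}w^\sigma)=\begin{cases}\omega^{\beta_1m_1+\beta_2m_2}+\omega^{-\beta_1m_1-\beta_2m_2} & (\sigma=0),\\ 0 & (\sigma=1),\end{cases}$$ where $\omega=\exp(2\pi i/3)$.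
   Context: Put $U=\langle x_1\rangle\times\langle x_2\rangle\cong C_3\times C_3$ and $W=\langle w\rangle\cong C_2$, so $G=U\rtimes W$, and every element of $G$ is uniquely of the form $x_1^{\beta_1}x_2^{\beta_2}w^\sigma$ with $0\le\beta_1,\beta_2\le2$, $\sigma\in\{0,1\}$. For $m_1,m_2\in\{-1,0,1\}$ (mod 3), $\rho_{m_1,m_2}$ is the one-dimensional character of $U$ with $\rho_{m_1,m_2}(x_k)=\omega^{m_k}$ $(k=1,2)$. For $(m_1,m_2)\neq(0,0)$, $\Pi_{m_1,m_2}=\mathrm{Ind}_U^G\,\rho_{m_1,m_2}$; in matrix form, $\Pi_{m_1,m_2}(u)=\mathrm{diag}(\rho_{m_1,m_2}(u),\rho_{-m_1,-m_2}(u))$ for $u\in U$ and $\Pi_{m_1,m_2}(w)=\begin{bmatrix}0&1\\1&0\end{bmatrix}$. *)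

(* Defs.v *)
From mathcomp Require Import all_boot all_order all_fingroup all_solvable.
From mathcomp Require Import all_algebra all_character.
From mathcomp Require Import complex.
From mathcomp Require Import reals sequences exp trigo.

Set Implicit Arguments.
Unset Strict Implicit.
Unset Printing Implicit Defensive.

Import GRing.Theory Num.Theory.

Local Open Scope ring_scope.

Section ComplexExponential.
Local Open Scope complex_scope.
Variable R : realType.

Definition cexp (z : R[i]) : R[i] :=
  let: a +i* b := z in (expR a * cos b) +i* (expR a * sin b).

Definition omega : R[i] := cexp (2 * (pi : R)%:C * 'i / 3).

End ComplexExponential.

Section InducedRepresentation.
Variables (F : fieldType) (gT : finGroupType) (G H : {group gT}).

(* The t i represent the left cosets of H in G, each exactly once. *)
Definition left_transversal k (t : 'I_k -> gT) : Prop :=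
  (forall i, t i \in G) /\
  (forall g, g \in G -> exists! i, ((t i)^-1 * g)%g \in H).

Variables (rho : mx_representation F H 1) (k : nat) (t : 'I_k -> gT).

(* Matrix of g on F[G] (x)_{F[H]} rho in the basis t i (x) 1:                *)
(* g t_j = t_i h with h \in H contributes the scalar rho h at (i, j).         *)
Definition induced_mx (g : gT) : 'M[F]_k :=
  \matrix_(i, j) (let h := ((t i)^-1 * g * t j)%g in
                  if h \in H then rho h 0 0 else 0).

Hypothesis trt : left_transversal t.

Lemma induced_mx_repr : mx_repr G induced_mx.
Proof.
case: trt => tG tex; split=> [|x y xG yG].
  apply/matrixP => i j; rewrite !mxE /= mulg1.
  have [<-|ne_ij] := eqVneq i j.
    by rewrite mulVg group1 repr_mx1 mxE eqxx.
  case: ifP => // tijH; case: (tex _ (tG j)) => l [_ lU].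
  case/eqP: ne_ij; rewrite -(lU i tijH); apply: lU.
  by rewrite mulVg group1.
apply/matrixP => i k0; rewrite !mxE /=.
have [j [jH jU]] := tex _ (groupM yG (tG k0)).
rewrite (bigD1 j) //= [X in _ + X]big1 ?addr0 => [|l ne_lj]; last first.
  rewrite !mxE /= [X in _ * X]ifF ?mulr0 //; apply/negP => lH.
  by case/eqP: ne_lj; apply/esym/jU; rewrite mulgA.
rewrite !mxE /= -mulgA in jH *.
have -> : ((t i)^-1 * (x * y * t k0)
        = ((t i)^-1 * x * t j) * ((t j)^-1 * (y * t k0)))%g.
  by rewrite !mulgA mulgK.
rewrite -!(mulgA (t j)^-1)%g jH groupMr //.
case: ifP => [iH|_]; last by rewrite mul0r.
by rewrite repr_mxM // mxE big_ord1.
Qed.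

Definition induced_repr : mx_representation F G k :=
  MxRepresentation induced_mx_repr.

End InducedRepresentation.

Section TheGroup.
Variable gT : finGroupType.
Local Open Scope group_scope.

(* \isog Grp only fixes G up to isomorphism; the other fields say that the    *)
(* given x1, x2, a are generators realising the presentation.                 *)
Record is_presented (G : {group gT}) (x1 x2 a : gT) : Prop := IsPresented {
  pres_isog : G \isog Grp (y1 : y2 : b :
                b ^+ 2 = 1, y1 ^+ 3 = 1, y2 ^+ 3 = 1, y1 * y2 = y2 * y1,
                b * y1 * b^-1 = y1^-1, b * y2 * b^-1 = y2^-1);
  pres_card : #|G| = 18;
  pres_gen : <<[set x1; x2; a]>> = G;
  pres_a2 : a ^+ 2 = 1;
  pres_x1 : x1 ^+ 3 = 1;
  pres_x2 : x2 ^+ 3 = 1;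
  pres_comm : x1 * x2 = x2 * x1;
  pres_ax1 : a * x1 * a^-1 = x1^-1;
  pres_ax2 : a * x2 * a^-1 = x2^-1
}.

Definition U_grp (x1 x2 : gT) : {group gT} := (<[x1]> <*> <[x2]>)%G.

Definition one_w (w : gT) (i : 'I_2) : gT := if i == ord0 then 1 else w.

Lemma one_w_transversal (G : {group gT}) (x1 x2 a : gT) :
  is_presented G x1 x2 a -> left_transversal G (U_grp x1 x2) (one_w a).
Proof.
case=> _ cG gen a2 e1 e2 cm ax1 ax2.
set U := U_grp x1 x2.
have nU : <[a]> \subset 'N(U).
  have x1U : x1 \in U by rewrite mem_gen // inE cycle_id.
  have x2U : x2 \in U by rewrite mem_gen // inE cycle_id orbT.
  rewrite cycle_subG -groupV inE /U /= conjYg -!cycleJ !conjgE invgK !mulgA.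
  by rewrite ax1 ax2 join_subG !cycle_subG !groupV x1U.
have GE : G = U * <[a]> :> {set gT}.
  rewrite -norm_joinEr // -gen /U /=; apply/eqP; rewrite eqEsubset; apply/andP; split.
    rewrite gen_subG; apply/subsetP => z; rewrite !inE -orbA.
    by case/or3P => /eqP ->; do ?[apply: mem_gen; rewrite !inE cycle_id ?orbT //];
      rewrite mem_gen // inE mem_gen // inE cycle_id ?orbT.
  rewrite !join_subG !cycle_subG.
  by rewrite !mem_gen // !inE eqxx ?orbT.
have cU : (#|U| <= 9)%N.
  have cx : commute x1 x2 by [].
  rewrite /U /= cent_joinEl; last first.
    by rewrite cents_cycle.
  have o1 : (#|<[x1]>| <= 3)%N by apply: dvdn_leq => //; rewrite order_dvdn e1.
  have o2 : (#|<[x2]>| <= 3)%N by apply: dvdn_leq => //; rewrite order_dvdn e2.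
  apply: leq_trans (leq_mul o1 o2); rewrite mul_cardG.
  by rewrite leq_pmulr // cardG_gt0.
have aU : a \notin U.
  apply/negP => aU; move: cU; suff -> : #|U| = 18 by [].
  by rewrite -cG GE mulGSid // cycle_subG.
have aG : a \in G by rewrite -gen mem_gen // !inE eqxx orbT.
split=> [i|g]; first by rewrite /one_w; case: ifP; rewrite ?group1.
rewrite {1}GE => /mulsgP[u v uU /cycleP[k ->] ->].
have ak : a ^+ k = if odd k then a else 1.
  by rewrite -[k in LHS]odd_double_half expgD -mul2n expgM a2 expg1n mulg1; case: odd.
rewrite {}ak; case: ifP => _; rewrite /one_w; last first.
  exists ord0; split=> [|i]; rewrite ?eqxx ?invg1 ?mul1g ?mulg1 //.
  by case: eqP => // _; rewrite groupMr // groupV (negPf aU).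
exists (lift ord0 ord0); split=> [|i].
  by rewrite /= -conjgE memJ_norm // (subsetP nU) ?cycle_id.
case: eqP => [_|/eqP i0 _]; first by rewrite invg1 mul1g groupMl // (negPf aU).
by apply/val_inj; case: i i0 => [[|[|]]].
Qed.

End TheGroup.

Section Pi.
Variables (F : fieldType) (gT : finGroupType) (G : {group gT}) (x1 x2 a : gT).
Hypothesis presG : is_presented G x1 x2 a.

(* Ind_U^G rho in the basis attached to the coset representatives (1, w);     *)
(* there u \in U acts by diag(rho u, rho u^-1) and w swaps the basis vectors. *)
(* Pi_{m1,m2} is the case where rho x_k = omega ^ m_k.                        *)
Definition Pi (rho : mx_representation F (U_grp x1 x2) 1) :
    mx_representation F G 2 :=
  induced_repr rho (one_w_transversal presG).

End Pi.

Definition trace_char (F : fieldType) (gT : finGroupType) (G : {group gT}) n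
    (rG : mx_representation F G n) (g : gT) : F :=
  \tr (rG g).

(* Main.v *)
(** The trace of the induced representation is the sum of the diagonal blocks
    [rho (t^-1 g t)] over the coset representatives [t = 1, w], extended by zero
    off [U]. For [g = u] in [U], conjugation by [w] inverts [u], which gives
    [rho u + rho u^-1]; for [g = u w] both conjugates lie outside [U]. *)

Require Import Defs.
From mathcomp Require Import all_boot all_order all_fingroup all_solvable.
From mathcomp Require Import all_algebra all_character.
From mathcomp Require Import complex.
From mathcomp Require Import reals sequences exp trigo.

Set Implicit Arguments.
Unset Strict Implicit.
Unset Printing Implicit Defensive.

Import GRing.Theory Num.Theory.

Local Open Scope ring_scope.

(** The modulus [expR x] is positive, and [cos y], [sin y] cannot both vanish because their squares
    sum to 1. *)
Lemma cexp_neq0 (R : realType) (z : R[i]) : cexp z != 0.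
Proof.
case: z => x y; rewrite eq_complex /= !mulf_eq0 !(negPf (lt0r_neq0 (expR_gt0 x))) /=.
apply/negP => /andP[/eqP c0 /eqP s0].
by have /eqP := cos2Dsin2 y; rewrite c0 s0 expr0n addr0 eq_sym oner_eq0.
Qed.

Lemma repr1_expg (F : fieldType) (gT : finGroupType) (H : {group gT})
    (rho : mx_representation F H 1) (x : gT) (c : F) n :
  x \in H -> rho x = c%:M -> rho (x ^+ n)%g = (c ^+ n)%:M.
Proof. by move=> xH rx; rewrite repr_mxX // rx -rmorphXn. Qed.

Section PresentedGroup.
Variables (gT : finGroupType) (G : {group gT}) (x1 x2 a : gT).
Hypothesis presG : is_presented G x1 x2 a.

Lemma x1_in_U : x1 \in U_grp x1 x2.
Proof. by rewrite mem_gen // inE cycle_id. Qed.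

Lemma x2_in_U : x2 \in U_grp x1 x2.
Proof. by rewrite mem_gen // inE cycle_id orbT. Qed.

(** Otherwise [1] and [a] would both represent the trivial coset, against uniqueness in the
    transversal. *)
Lemma a_notin_U : a \notin U_grp x1 x2.
Proof.
apply/negP => aU; have [_ /(_ 1%g (group1 G))[i [_ iU]]] := one_w_transversal presG.
have e0 : i = ord0 by apply: iU; rewrite mulg1 groupV /one_w eqxx group1.
have e1 : i = ord_max by apply: iU; rewrite mulg1 groupV.
by move: e1; rewrite e0 => /(congr1 val).
Qed.

Lemma conj_a_inv b1 b2 :
  ((x1 ^+ b1 * x2 ^+ b2) ^ a = (x1 ^+ b1 * x2 ^+ b2)^-1)%g.
Proof.
(* Since [a] is an involution, MathComp's [x ^ a], which is [a^-1 * x * a], agrees with the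
   [a * x * a^-1] of the presentation. *)
have aV : (a^-1 = a)%g by apply/eqP; rewrite eq_invg_mul; apply/eqP/(pres_a2 presG).
have cx : commute x1 x2 := pres_comm presG.
have conjE x : (x ^ a = a * x * a^-1)%g by rewrite conjgE aV mulgA.
rewrite conjMg !conjXg !conjE (pres_ax1 presG) (pres_ax2 presG) !expgVn -invMg.
(* Inverting a product reverses its factors; commutation restores their order. *)
by congr (_^-1)%g; apply/esym/commuteX2.
Qed.

Lemma trace_Pi (F : fieldType) (rho : mx_representation F (U_grp x1 x2) 1) g :
  trace_char (Pi presG rho) g =
    (if g \in U_grp x1 x2 then rho g 0 0 else 0)
    + (if (g ^ a)%g \in U_grp x1 x2 then rho (g ^ a)%g 0 0 else 0).
Proof.
rewrite /trace_char /mxtrace big_ord_recl big_ord1 !mxE /=.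
by rewrite /one_w /= invg1 mul1g mulg1 -mulgA -conjgE.
Qed.

End PresentedGroup.

Theorem theorem5p2 (R : realType) (gT : finGroupType) (G : {group gT})
    (x1 x2 a : gT) (presG : is_presented G x1 x2 a)
    (m1 m2 : int) (hm1 : m1 \in [:: -1; 0; 1]) (hm2 : m2 \in [:: -1; 0; 1])
    (hm : (m1, m2) != (0, 0))
    (rho : mx_representation R[i] (U_grp x1 x2) 1)
    (rho_x1 : rho x1 = (omega R ^ m1)%:M)
    (rho_x2 : rho x2 = (omega R ^ m2)%:M) :
  let w := a in
  forall b1 b2 sigma : nat, (b1 <= 2)%N -> (b2 <= 2)%N -> (sigma <= 1)%N ->
    trace_char (Pi presG rho) (x1 ^+ b1 * x2 ^+ b2 * w ^+ sigma)%g =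
      if sigma == 0%N then
        omega R ^ (b1%:Z * m1 + b2%:Z * m2)
        + omega R ^ (- (b1%:Z * m1) - b2%:Z * m2)
      else 0.
Proof.
move=> w b1 b2 sigma _ _ sigma1; rewrite {}/w trace_Pi.
set u := (x1 ^+ b1 * x2 ^+ b2)%g.
have uU : u \in U_grp x1 x2 by rewrite groupM // groupX ?x1_in_U ?x2_in_U.
case: sigma sigma1 => [|[|//]] _ /=.
  (* The exponents are integers, possibly negative, so adding them requires a nonzero base. *)
  have w0 : omega R != 0 := cexp_neq0 _.
  have ru : rho u = (omega R ^ (b1%:Z * m1 + b2%:Z * m2))%:M.
    rewrite repr_mxM ?groupX ?x1_in_U ?x2_in_U //.
    rewrite (repr1_expg _ (x1_in_U x1 x2) rho_x1) (repr1_expg _ (x2_in_U x1 x2) rho_x2).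
    by rewrite -scalar_mxM !exprnP !exprz_exp -expfzDr // ![_ * Posz _]mulrC.
  (* The second diagonal entry is [rho u^-1], the inverse of a scalar matrix, hence the power of
     [omega R] with opposite exponent. *)
  rewrite expg0 mulg1 (conj_a_inv presG) groupV uU repr_mxV // ru invmx_scalar.
  by rewrite !mxE !mulr1n invr_expz opprD.
(* Here [(u * a) ^ a = u^-1 * a], so both diagonal entries test membership in the coset of [a],
   which misses [U]. *)
rewrite expg1 conjMg [(a ^ a)%g]conjgE mulKg (conj_a_inv presG) -/u.
have uVU : (u^-1)%g \in U_grp x1 x2 by rewrite groupV.
by rewrite !(groupMl _ uU) (groupMl _ uVU) (negPf (a_notin_U presG)) addr0.
Qed.
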